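(* Let $\ell<0$ and let $F:\mathbb{R}^d\to\mathcal{CC}(\mathbb{R}^d)$ be an upper semicontinuous and $\ell$-relaxed one-sided Lipschitz set-valued mapping. Then for any $\bar y\in\mathbb{R}^d$ we have $$F^{-1}(\bar y)=\bigcap_{x\in\mathbb{R}^d}G_F(x,\bar y),$$ where $$G_F(x,\bar y)=\bigcup_{y\in F(x)}B\Big(x+\frac{1}{2\ell}(\bar y-y),\frac{1}{2|\ell|}\|\bar y-y\|\Big).$$
   Context: $\mathbb{R}^d$ carries the Euclidean norm $\|\cdot\|$ and the canonical inner product $\langle\cdot,\cdot\rangle$. For $z\in\mathbb{R}^d$ and $r\ge 0$, $B(z,r)=\{x\in\mathbb{R}^d:\|x-z\|\le r\}$ is the closed ball; for nonempty $X\subset\mathbb{R}^d$, $B_r(X)=\{x\in\mathbb{R}^d:\operatorname{dist}(x,X)\le r\}$ with $\operatorname{dist}(x,X)=\inf_{x'\in X}\|x-x'\|$, and $B_r(z)=B(z,r)$. $\mathcal{CC}(\mathbb{R}^d)$ is the collection of all nonempty convex compact subsets of $\mathbb{R}^d$. The preimage of $\bar y$ under $F:\mathbb{R}^d\to\mathcal{CC}(\mathbb{R}^d)$ is $F^{-1}(\bar y)=\{x\in\mathbb{R}^d:\bar y\in F(x)\}$. For $\ell\in\mathbb{R}$, $F$ is $\ell$-relaxed one-sided Lipschitz if for any $x,x'\in\mathbb{R}^d$ and any $y\in F(x)$ there exists $y'\in F(x')$ such that $\langle y'-y,x'-x\rangle\le\ell\|x'-x\|^2$. $F$ is upper semicontinuous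 if for every $x\in\mathbb{R}^d$ and $\varepsilon>0$ there exists $\delta>0$ such that $F(x')\subset B_\varepsilon(F(x))$ whenever $x'\in B_\delta(x)$. *)

(* Defs.v *)
From HB Require Import structures.
From mathcomp Require Import all_boot all_order all_algebra.
From mathcomp Require Import all_classical all_reals all_analysis.
Set Implicit Arguments.
Unset Strict Implicit.
Unset Printing Implicit Defensive.
Import Order.TTheory GRing.Theory Num.Theory.
Import numFieldNormedType.Exports.
Local Open Scope classical_set_scope.
Local Open Scope ring_scope.

Section Euclidean.
Context {R : realType} {d : nat}.
Implicit Types (x y z : 'rV[R]_d) (X : set 'rV[R]_d) (r : R).

Definition dot x y : R := \sum_(i < d) x ord0 i * y ord0 i.

(* The library norm `|x| on 'rV[R]_d is the sup norm, hence a separate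
   Euclidean norm; both induce the topology of 'rV[R]_d. *)
Definition enorm x : R := Num.sqrt (dot x x).

Definition cball z r : set 'rV[R]_d := [set x | enorm (x - z) <= r].

(* Meaningful for nonempty X only, as inf set0 = 0. *)
Definition dist x X : R := inf [set enorm (x - x') | x' in X].

Definition neighborhood r X : set 'rV[R]_d := [set x | dist x X <= r].

Definition convex_compact X : Prop :=
  [/\ X !=set0, convex_set X & compact X].

End Euclidean.

Section SetValued.
Context {R : realType} {d : nat}.
Implicit Types (F : 'rV[R]_d -> set 'rV[R]_d) (x y ybar : 'rV[R]_d) (l : R).

Definition set_preimage F y : set 'rV[R]_d := [set x | F x y].

Definition relaxed_one_sided_lipschitz l F : Prop :=
  forall x x' y, F x y ->
    exists2 y', F x' y' & dot (y' - y) (x' - x) <= l * enorm (x' - x) ^+ 2.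

Definition upper_semicontinuous F : Prop :=
  forall x (e : R), 0 < e -> exists2 delta : R, 0 < delta &
    forall x', cball x delta x' -> F x' `<=` neighborhood e (F x).

Definition G_F l F x ybar : set 'rV[R]_d :=
  \bigcup_(y in F x)
    cball (x + (1 / (2 * l)) *: (ybar - y))
          (1 / (2 * `|l|) * enorm (ybar - y)).

End SetValued.

(* Main.v *)
(* Expanding the square, the ball inequality defining [G_F l F x ybar] at [w]
   says [<ybar - y, w - x> <= l |w - x|^2], which is the relaxed one-sided
   Lipschitz inequality between [(w, ybar)] and [(x, y)].  This gives the
   inclusion from left to right.  Conversely, if [ybar] is not in [F w], let
   [v = ybar - p] with [p] the projection of [ybar] on [F w].  The points
   [x = w - t v], with [t] small and positive, carry some [y] in [F x] with
   [<ybar - y, v> <= 0], while by upper semicontinuity [y] is close to [F w],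
   on which [<ybar - y, v> >= |v|^2 > 0]. *)
Require Import Defs.
From HB Require Import structures.
From mathcomp Require Import all_boot all_order all_algebra.
From mathcomp Require Import all_classical all_reals all_analysis.
From mathcomp Require Import ring lra.
Import Order.TTheory GRing.Theory Num.Theory.
Import numFieldNormedType.Exports.
Local Open Scope classical_set_scope.
Local Open Scope ring_scope.

Section EuclideanTheory.
Context {R : realType} {d : nat}.
Implicit Types (x y z u v w : 'rV[R]_d) (X : set 'rV[R]_d) (k : R).

Lemma dotC x y : dot x y = dot y x.
Proof. by apply: eq_bigr => i _; rewrite mulrC. Qed.

Lemma dotDl x y z : dot (x + y) z = dot x z + dot y z.
Proof. by rewrite /dot -big_split; apply: eq_bigr => i _; rewrite !mxE mulrDl. Qed.

Lemma dotZl k x y : dot (k *: x) y = k * dot x y.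
Proof. by rewrite /dot mulr_sumr; apply: eq_bigr => i _; rewrite !mxE mulrA. Qed.

Lemma dotNl x y : dot (- x) y = - dot x y.
Proof. by rewrite -scaleN1r dotZl mulN1r. Qed.

Lemma dotDr x y z : dot x (y + z) = dot x y + dot x z.
Proof. by rewrite dotC dotDl !(dotC x). Qed.

Lemma dotZr k x y : dot x (k *: y) = k * dot x y.
Proof. by rewrite dotC dotZl dotC. Qed.

Lemma dotNr x y : dot x (- y) = - dot x y.
Proof. by rewrite dotC dotNl dotC. Qed.

Definition dotE := (dotDl, dotDr, dotNl, dotNr, dotZl, dotZr).

Lemma dot_ge0 x : 0 <= dot x x.
Proof. by apply: sumr_ge0 => i _; rewrite -expr2 sqr_ge0. Qed.

Lemma dot_gt0 x : x != 0 -> 0 < dot x x.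
Proof.
move=> x0; rewrite lt_neqAle dot_ge0 andbT eq_sym.
apply: contraNneq x0 => /eqP.
rewrite psumr_eq0 => [/allP xx0|i _]; last by rewrite -expr2 sqr_ge0.
apply/eqP/rowP => i; rewrite mxE.
by have := xx0 i (mem_index_enum i); rewrite /= mulf_eq0 orbb => /eqP.
Qed.

Lemma enorm_sqr x : enorm x ^+ 2 = dot x x.
Proof. by rewrite sqr_sqrtr ?dot_ge0. Qed.

Lemma enorm_ge0 x : 0 <= enorm x.
Proof. exact: sqrtr_ge0. Qed.

Lemma enorm_gt0 x : x != 0 -> 0 < enorm x.
Proof. by move=> x0; rewrite sqrtr_gt0 dot_gt0. Qed.

Lemma enormZ k x : enorm (k *: x) = `|k| * enorm x.
Proof.
by rewrite /enorm !dotE mulrA -expr2 sqrtrM ?sqr_ge0// sqrtr_sqr.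
Qed.

Lemma enorm_le_scale k x y :
  (enorm x <= `|k| * enorm y) = (dot x x <= k ^+ 2 * dot y y).
Proof.
by rewrite -sqrtr_sqr -sqrtrM ?sqr_ge0// ler_sqrt// mulr_ge0 ?sqr_ge0 ?dot_ge0.
Qed.

(** Expanding [0 <= dot (x - y) (x - y)] bounds [2 * dot x y] by [dot x x + dot y y]; this takes the
    place of Cauchy-Schwarz. *)
Lemma dot_lt_sqr x y : enorm x < enorm y -> dot x y < dot y y.
Proof.
move=> xy.
have : dot x x < dot y y by rewrite -!enorm_sqr ltr_pXn2r ?nnegrE ?enorm_ge0.
have := dot_ge0 (x - y); rewrite !dotE (dotC y x); lra.
Qed.

Lemma dot_continuous z : continuous (fun x => dot (z - x) (z - x)).
Proof.
apply: continuous_big => [|i _ x]; first exact: add_continuous.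
have zx : {for x, continuous (fun x : 'rV[R]_d => (z - x) ord0 i)}.
  under [X in {for x, continuous X}]eq_fun do rewrite !mxE.
  by apply: continuousB; [exact: cst_continuous|exact: coord_continuous].
exact: continuousM.
Qed.

Lemma convex_set_segment X x y k : convex_set X -> 0 <= k -> k <= 1 ->
  X x -> X y -> X (x + k *: (y - x)).
Proof.
move=> cX k0 k1 Xx Xy.
have := cX y x (Itv01 k0 k1); rewrite !inE => /(_ Xy Xx).
rewrite /conv/= scalerBl scale1r scalerBr.
by congr X; rewrite addrCA addrA.
Qed.

(** The point [p] minimises the squared distance to [z] on [X]; if the inequality failed at [y], a
    suitable step from [p] towards [y] would come closer to [z]. *)
Lemma convex_projection X z : convex_compact X ->
  exists2 p, X p & forall y, X y -> dot (y - p) (z - p) <= 0.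
Proof.
move=> [X0 cvX cX].
have /(compact_EVT_min X0 cX)[p] :
    {within X, continuous (fun y => dot (z - y) (z - y))}.
  by apply: continuous_subspaceT; exact: dot_continuous.
rewrite inE => Xp pmin; exists p => // y Xy; rewrite leNgt; apply/negP => s0.
set s := dot (y - p) (z - p) in s0.
have D0 : 0 < dot (y - p) (y - p) + s by rewrite ltr_wpDl ?dot_ge0.
(* With [u = y - p], the step [k] changes the squared distance by [k ^+ 2 * dot u u - 2 * k * s].
   The summand [s] in the denominator forces [k <= 1] and turns this change into
   [- k * s * (1 + k) < 0]. *)
set k := s / (dot (y - p) (y - p) + s).
have k0 : 0 < k by rewrite divr_gt0.
have k1 : k <= 1 by rewrite ler_pdivrMr// mul1r lerDr dot_ge0.
have /pmin : p + k *: (y - p) \in X.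
  by rewrite inE; apply: convex_set_segment => //; exact: ltW.
rewrite opprD addrA; move: (z - p) @s s0 @k D0 k0 k1 => v s s0 k D0 k0 k1.
have kE : k * (dot (y - p) (y - p) + s) = s by rewrite divfK ?gt_eqF.
move: (y - p) @s @k s0 D0 k0 k1 kE => u s k s0 D0 k0 k1 kE.
rewrite !dotE (dotC v u) -/s.
by clearbody s k; nra.
Qed.

End EuclideanTheory.

Lemma G_FP {R : realType} {d : nat} {l : R} {F : 'rV[R]_d -> set 'rV[R]_d}
    {x ybar w : 'rV[R]_d} : l < 0 ->
  G_F l F x ybar w <->
  exists2 y, F x y & dot (ybar - y) (w - x) <= l * dot (w - x) (w - x).
Proof.
move=> l0.
suff ballE y : cball (x + (1 / (2 * l)) *: (ybar - y))
      (1 / (2 * `|l|) * enorm (ybar - y)) w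
    <-> dot (ybar - y) (w - x) <= l * dot (w - x) (w - x).
  by split=> -[y Fxy /ballE]; exists y.
rewrite /cball /=.
have -> : 1 / (2 * `|l|) = `|1 / (2 * l)|.
  by rewrite normf_div normrM normr1 ger0_norm.
rewrite enorm_le_scale opprD addrA.
move: (ybar - y) (w - x) => b u.
rewrite !dotE (dotC u b).
set k := 1 / (2 * l).
have kl : 2 * k * l = 1 by rewrite /k; field; rewrite lt_eqF.
have k0 : k < 0 by rewrite /k div1r invr_lt0; lra.
(* Multiplying by [2 * k < 0], the inverse of [l], reverses the inequality. In the ball condition
   the terms [k ^+ 2 * dot b b] cancel, which leaves the same inequality. *)
have -> : dot b u <= l * dot u u = (dot u u <= 2 * k * dot b u).
  have k20 : 2 * k < 0 by lra.
  by rewrite -(ler_nM2l k20) (mulrA _ l) kl mul1r.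
by split=> H; nra.
Qed.

Theorem theorem5 (R : realType) (d : nat) (l : R)
    (F : 'rV[R]_d -> set 'rV[R]_d)
    (hl : l < 0)
    (hF : forall x : 'rV[R]_d, convex_compact (F x))
    (husc : upper_semicontinuous F)
    (hrosl : relaxed_one_sided_lipschitz l F) :
  forall ybar : 'rV[R]_d,
    set_preimage F ybar = \bigcap_(x in [set: 'rV[R]_d]) G_F l F x ybar.
Proof.
move=> ybar; apply/seteqP; split=> w /=.
  move=> Fw x _; apply/(G_FP hl).
  have [y Fxy] := hrosl w x ybar Fw.
  rewrite enorm_sqr -(opprB w x) -(opprB ybar y) !dotNr !dotNl !opprK => h.
  by exists y.
move=> Gw.
have [p Fp pE] := convex_projection (F w) ybar (hF w).
set v := ybar - p in pE.
have [/subr0_eq->//|v0] := eqVneq v 0.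
have n0 := enorm_gt0 v v0.
(* A tolerance strictly below [enorm v] is what later yields a point of [F w] at distance less than
   [enorm v] from [y], although the infimum [dist] is only bounded by a weak inequality. *)
have [delta delta0 usc] := husc w (enorm v / 2) (divr_gt0 n0 (ltr0n _ 2)).
(* This makes the length of [t *: v] exactly [delta], so that [w - t *: v] still lies in the closed
   ball. *)
set t := delta / enorm v.
have t0 : 0 < t by rewrite divr_gt0.
have ball_wt : cball w delta (w - t *: v).
  rewrite /cball /= addrAC subrr add0r -scaleNr enormZ normrN gtr0_norm//.
  by rewrite divfK ?gt_eqF.
have [y Fy] := (G_FP hl).1 (Gw (w - t *: v) I).
rewrite subKr dotZr => yE.
have yv : dot (ybar - y) v <= 0.
  rewrite -(pmulr_rle0 _ t0) (le_trans yE)//.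
  by rewrite mulr_le0_ge0 ?dot_ge0 ?ltW.
have := usc _ ball_wt y Fy; rewrite /neighborhood /= /dist => dy.
have [||_ [q Fq <-] /dot_lt_sqr qv] :=
  @inf_lt R [set enorm (y - q) | q in F w] (enorm v).
- by exists (enorm (y - p)), p.
- by rewrite (le_lt_trans dy)// ltr_pdivrMr//; lra.
have := pE q Fq.
(* The right-hand side is positive by [yv] and [qv], against the projection inequality at [q]. The
   identity splits [q - p] as [v - (ybar - y) - (y - q)]. *)
suff : dot (q - p) v = dot v v - dot (ybar - y) v - dot (y - q) v by lra.
by rewrite {2}/v !dotE; ring.
Qed.
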